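(* Let $\Delta$ and $m$ be positive integers and let $p\in(0,1]$. Then there exists a positive integer $c=c(\Delta,m,p)$ such that almost all graphs $F\in\mathcal{G}(cn,p)$ satisfy $F\to G$ for every graph $G$ of order $n$ in $\mathcal{F}_{\Delta,m}$; that is, $$\lim_{n\to\infty}\Pr\big[F\in\mathcal{G}(cn,p):\ F\to G\ \text{for every graph } G\in\mathcal{F}_{\Delta,m}\text{ with } n \text{ vertices}\big]=1.$$
   Context: All graphs are finite and simple. For graphs $F$ and $G$, $F\to G$ means that every coloring of the edges of $F$ with the two colors red and blue contains a monochromatic copy of $G$ (as a not necessarily induced subgraph). $\mathcal{G}(N,p)$ is the Erdős–Rényi random graph space on a labelled vertex set of size $N$, in which each edge of $K_N$ appears independently with probability $p$. ''Almost all graphs in $\mathcal{G}(N,p)$ have property $P$'' means that $\Pr[F\in\mathcal{G}(N,p): F\text{ has }P]\to1$ as $N\to\infty$. $\mathcal{F}_{\Delta,m}$ is the family of graphs in which all but at most $m$ vertices have degree at most $\Delta$. The order of a graph is its number of vertices. *)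

(* Defs.v *)
From HB Require Import structures.
From mathcomp Require Import all_boot all_order all_algebra.
From mathcomp Require Import all_classical all_reals all_analysis.
Import numFieldNormedType.Exports.

Set Implicit Arguments.
Unset Strict Implicit.
Unset Printing Implicit Defensive.

Local Open Scope ring_scope.

(* The edge set of the complete graph on T. *)
Definition pairs (T : finType) : {set {set T}} :=
  [set e : {set T} | #|e| == 2%N].

(* Simple graphs with vertex set T; they form a finite type. *)
Record sgraph (T : finType) := SGraph {
  edges : {set {set T}};
  edges_sub : edges \subset pairs T }.

HB.instance Definition _ (T : finType) := [isSub for @edges T].
HB.instance Definition _ (T : finType) := [Finite of sgraph T by <:].

Definition degree (T : finType) (G : sgraph T) (x : T) : nat :=
  #|[set y : T | [set x; y] \in edges G]|.

(* All but at most m vertices of G have degree at most Delta. *)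
Definition almost_bounded_degree (Delta m : nat) (T : finType)
    (G : sgraph T) : Prop :=
  (#|[set x : T | ~~ (degree G x <= Delta)%N]| <= m)%N.

(* col is a red/blue edge colouring of F; its values outside [edges F] play no
   role. The injection f embeds G in F, not necessarily as an induced
   subgraph. *)
Definition monochromatic_copy (T V : finType) (F : sgraph T)
    (col : {set T} -> bool) (G : sgraph V) : Prop :=
  exists (b : bool) (f : V -> T), injective f /\
    forall e : {set V}, e \in edges G ->
      f @: e \in edges F /\ col (f @: e) = b.

Definition arrows (T V : finType) (F : sgraph T) (G : sgraph V) : Prop :=
  forall col : {set T} -> bool, monochromatic_copy F col G.

(* The probability of F in G(N, p): every pair is an edge independently with
   probability p. *)
Definition gnp_weight (R : realType) (N : nat) (p : R) (F : sgraph 'I_N) : R :=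
  \prod_(e in pairs 'I_N) (if e \in edges F then p else 1 - p).

Definition gnp_prob (R : realType) (N : nat) (p : R)
    (P : set (sgraph 'I_N)) : R :=
  \sum_(F : sgraph 'I_N | F \in P) gnp_weight p F.

(* F -> G for every graph G of order n, on an arbitrary n-element vertex type,
   with all but at most m vertices of degree at most Delta. *)
Definition universal_arrows (Delta m n : nat) (T : finType)
    (F : sgraph T) : Prop :=
  forall (V : finType) (G : sgraph V),
    #|V| = n -> almost_bounded_degree Delta m G -> arrows F G.

(* Main.v *)
(* Put r = Delta + m. A random graph F on N = c n vertices satisfies, with
   probability tending to 1, the following: whenever |X|, |Y| >= n, some x in X
   has at least |Y| / q0 neighbours in Y. This is Markov's inequality for
   2 ^ - e(X, Y) and a union bound over the 4 ^ N pairs (X, Y), since the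
   failure probability for one pair is exponentially small in n ^ 2.

   For such an F the Ramsey property is deterministic. If in a colouring the red
   graph is dense between all large subsets of a vertex set X0, then G embeds in
   red inside X0: first the m exceptional vertices, shrinking X0 to the common
   neighbourhood of their images, then the others in the order of decreasing
   colour of a proper (Delta + 1)-colouring, keeping candidate sets. Otherwise
   X0 contains large X and Y such that each vertex of X has few red neighbours
   in Y. Repeating this inside X gives parts Y_0, ..., Y_r such that the vertices
   of Y_i have few red neighbours in Y_j for j < i. Between subsets of these
   parts F is dense and red is negligible, so blue is dense, and the same
   embedding works in blue. *)
Require Import Defs.
From mathcomp Require Import all_boot all_order all_algebra.
From mathcomp Require Import all_classical all_reals all_analysis.
From mathcomp Require Import zify ring lra.
Import numFieldNormedType.Exports.

(** * Greedy embedding into a relation that is dense between parts *)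

(** [Y] is measured relative to [S j], because a candidate set there may shrink by the factor [q] up
    to [r] times. [X] is measured absolutely, because it stands for a set of bad images. *)
Definition dense {T : finType} (H : rel T) (q r a K : nat)
    (S : nat -> {set T}) : Prop :=
  forall (i j : nat) (X Y : {set T}), j < i < K ->
    X \subset S i -> Y \subset S j -> a <= #|X| -> #|S j| <= q ^ r * #|Y| ->
    exists2 x, x \in X & #|Y| <= q * #|Y :&: [set y | H x y]|.

Definition embeds {T V : finType} (H : rel T) (G : sgraph V) (B : {set V})
    (f : V -> T) : Prop :=
  {in B &, injective f} /\
  {in B &, forall u v, [set u; v] \in edges G -> H (f u) (f v)}.

Lemma edge_neq {T : finType} (G : sgraph T) x y :
  [set x; y] \in edges G -> x != y.
Proof.
move=> e; apply/eqP => xy; move: (fintype.subsetP (edges_sub G) _ e).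
by rewrite xy inE finset.setUid cards1.
Qed.

(** Greedy induction: the neighbours of a removed vertex occupy at most [Delta] of the [Delta + 1]
    colours. *)
Lemma exists_proper_colouring {V : finType} (G : sgraph V) (Delta : nat)
    (B : {set V}) :
  {in B, forall v, degree G v <= Delta} ->
  exists2 c : V -> nat, forall v, c v <= Delta &
    {in B &, forall u v, [set u; v] \in edges G -> c u != c v}.
Proof.
have [k] := ubnP #|B|; elim: k B => // k IH B Bk degB.
have [->|[v vB]] := set_0Vmem B.
  by exists (fun=> 0) => // u w; rewrite inE.
have Bvk : #|B :\ v| < k by rewrite (cardsD1 v) vB in Bk.
have degBv : {in B :\ v, forall u, degree G u <= Delta}.
  by move=> u /setD1P[_ /degB].
have [c cD cP] := IH _ Bvk degBv.
pose used := [set (inord (c y) : 'I_Delta.+1) | y in [set y | [set v; y] \in edges G]].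
have : exists i, i \notin used.
  apply/existsP; rewrite -negb_forall; apply/negP => /forallP full.
  suff : #|'I_Delta.+1| <= Delta by rewrite card_ord ltnn.
  apply: leq_trans (degB _ vB); apply: leq_trans (leq_imset_card _ _).
  by apply: subset_leq_card; apply/fintype.subsetP => i _; apply: full.
case=> i iP.
have fresh u : [set v; u] \in edges G -> c u != i.
  move=> vu; apply: contraNneq iP => cu; apply/imsetP; exists u; rewrite ?inE //.
  by apply: val_inj; rewrite /= inordK // ltnS.
exists (fun u => if u == v then i : nat else c u) => [u|u w uB wB uw].
  by case: eqP => // _; rewrite -ltnS.
have uNw := edge_neq _ _ _ uw.
case: (eqVneq u v) uw uNw => [->|uv] uw uNw.
  by rewrite [w == v]eq_sym (negPf uNw) eq_sym fresh.
case: (eqVneq w v) uw => [->|wv] uw; first by rewrite fresh // finset.setUC.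
by apply: cP; rewrite ?inE ?uv ?wv.
Qed.

Lemma exists_avoiding {T I : finType} (A : {set T}) (J : {set I})
    (bad : I -> {set T}) (a k : nat) :
  {in J, forall j, #|bad j| <= a} -> #|J| <= k -> k * a < #|A| ->
  exists2 x, x \in A & {in J, forall j, x \notin bad j}.
Proof.
move=> badP Jk kaA.
have : ~~ (A \subset \bigcup_(j in J) bad j).
  apply/negP => /subset_leq_card; apply/negP; rewrite -ltnNge.
  apply: leq_ltn_trans kaA; apply: leq_trans (leq_mul Jk (leqnn a)).
  rewrite -sum_nat_const.
  apply: (@leq_trans (\sum_(j in J) #|bad j|)); last exact: leq_sum.
  elim/big_rec2: _ => [|j n B _ le]; first by rewrite cards0.
  by apply: leq_trans (leq_card_setU _ _) _; rewrite leq_add2l.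
case/subsetPn => x xA xN; exists x => // j jJ.
by apply: contra xN => xj; apply/bigcupP; exists j.
Qed.

(** More than [a] bad vertices would themselves form an [X] that contradicts [dense]. *)
Lemma dense_bad {T : finType} (H : rel T) (q r a K : nat) (S : nat -> {set T})
    (i j : nat) (X Y : {set T}) :
  dense H q r a K S -> j < i < K -> X \subset S i -> Y \subset S j ->
  #|S j| <= q ^ r * #|Y| ->
  #|[set x in X | q * #|Y :&: [set y | H x y]| < #|Y|]| <= a.
Proof.
move=> dH ji XS YS SY; rewrite leqNgt; apply/negP => /ltnW aX.
have badS : [set x in X | q * #|Y :&: [set y | H x y]| < #|Y|] \subset S i.
  by apply: fintype.subset_trans XS; apply/fintype.subsetP => x; rewrite inE => /andP[].
have [x] := dH _ _ _ _ ji badS YS aX SY.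
by rewrite inE ltnNge => /andP[_ /negP].
Qed.

(* [Z] collects the vertices already used. Vertices are embedded in the order
   of decreasing colour, and the candidate set of [w] loses a factor [q] each
   time a neighbour of [w] leaves [B]. *)
Lemma embed_candidates {T V : finType} (H : rel T) (G : sgraph V)
    (q Delta a n : nat) (S : nat -> {set T}) (c : V -> nat)
    (B : {set V}) (Z : {set T}) (C : V -> {set T}) :
  T -> 0 < q -> symmetric H -> dense H q Delta a Delta.+1 S ->
  (forall v, c v <= Delta) ->
  (forall i, i <= Delta -> q ^ Delta * (n + Delta * a) <= #|S i|) ->
  {in B, forall v, degree G v <= Delta} ->
  {in B &, forall u v, [set u; v] \in edges G -> c u != c v} ->
  #|Z| + #|B| <= n ->
  (forall v, C v \subset S (c v)) ->
  {in B, forall v, q ^ #|[set w in B | [set v; w] \in edges G]| * #|S (c v)|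
                   <= q ^ Delta * #|C v|} ->
  exists2 f, embeds H G B f & {in B, forall v, f v \in C v :\: Z}.
Proof.
move=> x0 q0 symH dH cD largeS.
have [k] := ubnP #|B|; elim: k B Z C => // k IH B Z C Bk degB cP ZB CS Cq.
have [B0|[v0 v0B]] := set_0Vmem B.
  by exists (fun=> x0); last (by rewrite B0 => v; rewrite inE); split => u v;
    rewrite B0 inE.
(* Maximality and properness give the neighbours of [v] in [B] strictly smaller colours, which is
   the order j < i that [dense] requires. *)
pose v := [arg max_(u > v0 in B) c u].
have [vB vmax] : v \in B /\ {in B, forall u, c u <= c v}.
  by rewrite /v; case: arg_maxnP => // w wB wmax; split=> // u /wmax.
have qpow e : 0 < q ^ e by rewrite expn_gt0 q0.
have SC w : w \in B -> #|S (c w)| <= q ^ Delta * #|C w|.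
  by move=> wB; apply: leq_trans (Cq w wB); rewrite leq_pmull.
pose J := [set w in B | [set v; w] \in edges G].
pose bad w := [set x in C v | q * #|C w :&: [set y | H x y]| < #|C w|].
have JP : {in J, forall w, c w < c v}.
  move=> w; rewrite inE => /andP[wB vw]; rewrite ltn_neqAle vmax // andbT.
  by rewrite eq_sym cP.
have badP : {in J, forall w, #|bad w| <= a}.
  move=> w wJ; apply: (dense_bad H q Delta a Delta.+1 S (c v) (c w)) => //.
  - by rewrite JP //= ltnS.
  - by apply: SC; move: wJ; rewrite inE => /andP[].
have Jk : #|J| <= Delta.
  apply: leq_trans (degB _ vB); apply: subset_leq_card; apply/fintype.subsetP => w.
  by rewrite !inE => /andP[].
have BvB : #|B| = #|B :\ v|.+1 by rewrite (cardsD1 v) vB.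
(* Cancelling q ^ Delta leaves at least n + Delta * a candidates for [v]; fewer than [n] of them are
   used, since [B] is nonempty. *)
have big : Delta * a < #|C v :\: Z|.
  have := leq_trans (largeS _ (cD v)) (SC v vB).
  rewrite leq_pmul2l // cardsD => large.
  have := subset_leq_card (finset.subsetIr (C v) Z); lia.
have [x /setDP[xC xZ] xgood] := exists_avoiding _ _ _ _ _ badP Jk big.
pose C' w := if [set v; w] \in edges G then C w :&: [set y | H x y] else C w.
have BvP u : u \in B :\ v -> u \in B by case/setD1P.
have [|||||w wB|f [finj fhom] fC] := IH (B :\ v) (x |: Z) C'.
- by rewrite -ltnS -BvB.
- by move=> u /BvP/degB.
- by move=> u w /BvP uB /BvP wB; apply: cP.
- by rewrite cardsU1 xZ; rewrite BvB in ZB; lia.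
- move=> w; rewrite /C'; case: ifP => _ //.
  by apply: fintype.subset_trans (CS w); apply: finset.subsetIl.
- have wB' := BvP _ wB; rewrite /C'; case: ifPn => vw.
    have wJ : w \in J by rewrite inE wB'.
    have := xgood _ wJ; rewrite inE xC /= -leqNgt => xw.
    have := Cq _ wB'.
    rewrite (cardsD1 v) inE vB finset.setUC vw add1n expnS.
    have -> : [set u in B | [set w; u] \in edges G] :\ v
              = [set u in B :\ v | [set w; u] \in edges G].
      by apply/setP => u; rewrite !inE andbA.
    move=> Cw; rewrite -(leq_pmul2l q0) mulnA; apply: leq_trans Cw _.
    by rewrite mulnCA leq_mul2l xw orbT.
  apply: leq_trans (Cq _ wB'); rewrite leq_mul2r leq_pexp2l ?orbT //.
  apply: subset_leq_card; apply/fintype.subsetP => u.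
  by rewrite !inE => /andP[/andP[_ ->]].
exists (fun w => if w == v then x else f w).
- split=> [u w uB wB|u w uB wB uw].
    case: (eqVneq u v) => [->|uv]; case: (eqVneq w v) => [->|wv] //.
    + have wB' : w \in B :\ v by rewrite !inE wv.
      by move=> e; have := fC _ wB'; rewrite -e !inE eqxx.
    + have uB' : u \in B :\ v by rewrite !inE uv.
      by move=> e; have := fC _ uB'; rewrite e !inE eqxx.
    + by apply: finj; rewrite !inE ?uv ?wv.
  have adj z : z \in B :\ v -> [set v; z] \in edges G -> H x (f z).
    by move=> /fC; rewrite /C' => + vz; rewrite vz !inE => /and3P[].
  have := edge_neq _ _ _ uw.
  case: (eqVneq u v) uw => [->|uv] uw; case: (eqVneq w v) uw => [->|wv] uw //.
  + by rewrite adj // !inE wv.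
  + by rewrite symH adj // ?(finset.setUC [set v]) // !inE uv.
  + by rewrite fhom // !inE ?uv ?wv.
- move=> w wB; case: (eqVneq w v) => [->|wv]; first by rewrite inE xC xZ.
  have /fC : w \in B :\ v by rewrite !inE wv.
  rewrite /C' !inE negb_or => /andP[/andP[_ ->]] /=.
  by case: ifP => // _; rewrite !inE => /andP[].
Qed.

(** Cutting a part down to a 1/q share spends one of the factors [q] that [dense] allows for [Y].
    The last part is given up. *)
Lemma dense_shrink {T : finType} (H : rel T) (q r a K : nat)
    (S S' : nat -> {set T}) :
  dense H q r.+1 a K.+1 S -> (forall i, S' i \subset S i) ->
  (forall i, i < K -> #|S i| <= q * #|S' i|) -> dense H q r a K S'.
Proof.
move=> dS S'S cS i j X Y ji XS YS aX SY.
apply: (dS i j) => //.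
- by case/andP: ji => -> /= /ltnW.
- exact: fintype.subset_trans XS (S'S i).
- exact: fintype.subset_trans YS (S'S j).
- apply: leq_trans (cS j _) _; first by case/andP: ji; apply: ltn_trans.
  by rewrite expnS -mulnA leq_mul2l SY orbT.
Qed.

(* The [h] vertices of large degree are embedded first, as if they were joined
   to all other vertices: every part is cut down to the neighbourhood of their
   images. *)
Lemma embed_in_dense {T V : finType} (H : rel T) (G : sgraph V)
    (q Delta a n h : nat) (S : nat -> {set T}) (B : {set V}) :
  T -> 0 < q -> symmetric H -> irreflexive H ->
  dense H q (Delta + h) a (Delta + h).+1 S ->
  (forall i, i <= Delta + h ->
     q ^ (Delta + h) * (n + (Delta + h).+1 * a) <= #|S i|) ->
  #|B| <= n -> #|[set v in B | ~~ (degree G v <= Delta)]| <= h ->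
  0 < n ->
  exists2 f, embeds H G B f &
    {in B, forall v, exists2 i, i <= Delta + h & f v \in S i}.
Proof.
move=> x0 q0 symH irrH; elim: h S B => [|h IH] S B.
  rewrite addn0 => dS large Bn; rewrite leqn0 cards_eq0 => /eqP high0 n0.
  have degB : {in B, forall v, degree G v <= Delta}.
    move=> v vB; apply: contraT => vN.
    by have := finset.in_set0 v; rewrite -high0 !inE vB vN.
  have [c cD cP] := exists_proper_colouring G Delta B degB.
  have [||||f fP fS] := embed_candidates H G q Delta a n S c B finset.set0
     (fun v => S (c v)) x0 q0 symH dS cD _ degB cP.
  - move=> i iD; apply: leq_trans (large i iD); rewrite leq_mul2l; apply/orP.
    by right; rewrite mulSn; lia.
  - by rewrite cards0.
  - by [].
  - move=> v vB; rewrite leq_mul2r leq_pexp2l ?orbT //.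
    apply: leq_trans (degB v vB); apply: subset_leq_card.
    by apply/fintype.subsetP => w; rewrite !inE => /andP[].
  exists f => // v /fS; rewrite inE => /andP[_ fv]; by exists (c v).
rewrite addnS => dS large Bn high n0.
set K := Delta + h in dS large IH *.
(* The image of an exceptional vertex comes from the last part, since [dense] controls only
   neighbours in parts of smaller index. *)
pose bad (i : 'I_K.+1) :=
  [set x in S K.+1 | q * #|S i :&: [set y | H x y]| < #|S i|].
have badP : {in [set: 'I_K.+1]%SET, forall i, #|bad i| <= a}.
  move=> i _; apply: (dense_bad H q K.+1 a K.+2 S K.+1 i) => //.
  - by rewrite ltn_ord ltnSn.
  - by rewrite leq_pmull // expn_gt0 q0.
have big : K.+1 * a < #|S K.+1|.
  apply: leq_trans (large _ (leqnn _)).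
  have := @leq_pmull (n + K.+2 * a) (q ^ K.+1).
  rewrite expn_gt0 q0 => /(_ isT); rewrite (mulSn K.+1); lia.
have [|x xS xgood] := exists_avoiding _ _ _ _ _ badP _ big.
  by rewrite cardsT card_ord.
pose S' i := S i :&: [set y | H x y].
have cS i : i < K.+1 -> #|S i| <= q * #|S' i|.
  move=> iK; have := xgood (Ordinal iK) (finset.in_setT _).
  by rewrite inE xS /= -leqNgt.
have S'S i : S' i \subset S i by apply: finset.subsetIl.
have dS' : dense H q K a K.+1 S' by apply: dense_shrink dS S'S cS.
have large' i : i <= K -> q ^ K * (n + K.+1 * a) <= #|S' i|.
  move=> iK; rewrite -(leq_pmul2l q0); apply: leq_trans (cS i iK).
  apply: leq_trans (large i (leqW iK)); rewrite mulnA -expnS leq_mul2l.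
  by rewrite leq_add2l leq_mul2r leqnSn !orbT.
have S'H i y : y \in S' i -> H x y by rewrite !inE => /andP[].
have [v vP|none] := pickP [pred v in B | ~~ (degree G v <= Delta)].
  case/andP: vP => vB vN.
  have BvP u : u \in B :\ v -> u \in B by case/setD1P.
  have [||f [finj fhom] fS] := IH S' (B :\ v) dS' large' _ _ n0.
  - by apply: leq_trans Bn; apply: subset_leq_card; apply: finset.subD1set.
  - rewrite -ltnS; apply: leq_trans high.
    rewrite [in leqRHS](cardsD1 v) inE vB vN add1n ltnS.
    by apply: subset_leq_card; apply/fintype.subsetP => u; rewrite !inE andbA.
  have adj z : z \in B :\ v -> H x (f z) by case/fS => i _ /S'H.
  have fresh z : z \in B :\ v -> f z != x.
    (* All other images are neighbours of [x], so irreflexivity alone keeps them distinct from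
       [x]. *)
    by move=> /adj; apply: contraTneq => ->; rewrite irrH.
  exists (fun w => if w == v then x else f w).
    split=> [u w uB wB|u w uB wB uw].
      case: (eqVneq u v) => [->|uv]; case: (eqVneq w v) => [->|wv] //.
      + by move/esym/eqP; rewrite (negPf (fresh w _)) // !inE wv.
      + by move/eqP; rewrite (negPf (fresh u _)) // !inE uv.
      + by apply: finj; rewrite !inE ?uv ?wv.
    have := edge_neq _ _ _ uw.
    case: (eqVneq u v) uw => [->|uv] uw; case: (eqVneq w v) uw => [->|wv] uw //.
    + by rewrite adj // !inE wv.
    + by rewrite symH adj // !inE uv.
    + by rewrite fhom // !inE ?uv ?wv.
  move=> w wB /=; case: eqVneq => [_|wv]; first by exists K.+1.
  have /fS[i iK] : w \in B :\ v by rewrite !inE wv.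
  by rewrite inE => /andP[fi _]; exists i => //; apply: leqW.
have [||f fP fS] := IH S' B dS' large' _ _ n0.
- done.
- rewrite (_ : [set v in B | ~~ (degree G v <= Delta)] = finset.set0) ?cards0 //.
  by apply/setP => v; rewrite !inE; apply: none.
exists f => // v /fS[i iK]; rewrite inE => /andP[fi _]; exists i => //.
exact: leqW.
Qed.

(** * Monochromatic copies from a dense colour class *)

Definition colour_class {T : finType} (F : sgraph T) (col : {set T} -> bool)
    (b : bool) : rel T :=
  fun x y => ([set x; y] \in edges F) && (col [set x; y] == b).

Lemma colour_class_sym {T : finType} (F : sgraph T) col b :
  symmetric (colour_class F col b).
Proof. by move=> x y; rewrite /colour_class finset.setUC. Qed.

Lemma colour_class_irr {T : finType} (F : sgraph T) col b :
  irreflexive (colour_class F col b).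
Proof.
by move=> x; apply/negP => /andP[/edge_neq]; rewrite eqxx.
Qed.

Lemma dense_monochromatic_copy {T V : finType} (F : sgraph T)
    (col : {set T} -> bool) (b : bool) (G : sgraph V) (q Delta m a : nat)
    (S : nat -> {set T}) :
  0 < q -> 0 < #|V| -> almost_bounded_degree Delta m G ->
  dense (colour_class F col b) q (Delta + m) a (Delta + m).+1 S ->
  (forall i, i <= Delta + m ->
     q ^ (Delta + m) * (#|V| + (Delta + m).+1 * a) <= #|S i|) ->
  monochromatic_copy F col G.
Proof.
move=> q0 V0 degG dS large.
have [x0 _] : exists x, x \in S 0.
  apply/set0Pn; rewrite -card_gt0; apply: leq_trans (large 0 _) => //.
  by rewrite muln_gt0 expn_gt0 q0 addn_gt0 V0.
have [||f [finj fhom] _] := embed_in_dense (colour_class F col b) G q Delta a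
  #|V| m S [set: V]%SET x0 q0 (colour_class_sym F col b)
  (colour_class_irr F col b) dS large _ _ V0.
- by rewrite cardsT.
- apply: leq_trans degG; apply: subset_leq_card.
  by apply/fintype.subsetP => v; rewrite !inE.
exists b, f; split=> [u v|e eG]; first by apply: finj; rewrite inE.
have := fintype.subsetP (edges_sub G) _ eG; rewrite inE.
case/cards2P => u [v [_ e_uv]]; rewrite e_uv in eG *.
rewrite imsetU1 imset_set1.
by have /andP[? /eqP] := fhom u v (finset.in_setT _) (finset.in_setT _) eG.
Qed.

(** * The Ramsey property of quasirandom graphs *)

Definition quasirandom {T : finType} (n q0 : nat) (F : sgraph T) : Prop :=
  forall X Y : {set T}, n <= #|X| -> n <= #|Y| ->
    exists2 x, x \in X & #|Y| <= q0 * #|Y :&: [set y | [set x; y] \in edges F]|.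

(* If colour [b] contains no copy of [G], it is not dense in [X0]; this yields
   [Y 0] and a set [X] in [X0] such that every vertex of [X] sends few edges of
   colour [b] to [Y 0], and the remaining parts are found inside [X]. *)
Lemma sparse_chain {T V : finType} (F : sgraph T) (col : {set T} -> bool)
    (b : bool) (G : sgraph V) (q Delta m : nat) (s : nat -> nat) (k : nat)
    (X0 : {set T}) :
  0 < q -> 0 < #|V| -> almost_bounded_degree Delta m G ->
  (forall i, s i.+1 = q ^ (Delta + m) * (#|V| + (Delta + m).+1 * s i)) ->
  s k <= #|X0| ->
  monochromatic_copy F col G \/
  exists Y : nat -> {set T}, forall i, i < k ->
    [/\ Y i \subset X0, s 0 <= #|Y i| &
      forall j, j < i -> {in Y i, forall y,
        q * #|Y j :&: [set z | colour_class F col b y z]| < #|Y j|}].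
Proof.
move=> q0 V0 degG sS; elim: k X0 => [|k IH] X0 sX0.
  by right; exists (fun=> finset.set0).
have sle i : s i <= s i.+1.
  by rewrite sS -[leqLHS]mul1n leq_mul ?expn_gt0 ?q0 // mulSn; lia.
have s0 i : s 0 <= s i by elim: i => // i; move/leq_trans; apply.
(* Density is tested with every part equal to [X0]; the recursion for [s] is the part size that the
   embedding needs when a = s k. *)
have [dX0|] := pselect (dense (colour_class F col b) q (Delta + m) (s k)
                          (Delta + m).+1 (fun=> X0)).
  left; apply: dense_monochromatic_copy q0 V0 degG dX0 _ => i _.
  by rewrite -sS.
have [[X [Y [XX0 YX0 sX sY XY]]] _|nXY dX0] := pselect (exists X Y : {set T},
    [/\ X \subset X0, Y \subset X0, s k <= #|X|,
      #|X0| <= q ^ (Delta + m) * #|Y| &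
      {in X, forall x, q * #|Y :&: [set y | colour_class F col b x y]| < #|Y|}]);
  last first.
  case: dX0 => i j X Y _ XX0 YX0 sX sY.
  have [x /andP[xX xY]|none] := pickP [pred x in X |
     #|Y| <= q * #|Y :&: [set y | colour_class F col b x y]|].
    by exists x.
  case: nXY; exists X, Y; split=> // x xX.
  by have /= := none x; rewrite xX /= leqNgt => /negbFE.
have [|[Y' Y'P]] := IH X sX; [by left | right].
exists (fun i => if i is i'.+1 then Y' i' else Y) => -[_|i].
  split=> //.
  have := leq_trans sX0 sY; rewrite sS leq_pmul2l ?expn_gt0 ?q0 //.
  by have := s0 k; rewrite mulSn; lia.
rewrite ltnS => /Y'P[Y'X sY' Y'j]; split=> //.
  exact: fintype.subset_trans Y'X XX0.
by case=> [_ y /(fintype.subsetP Y'X)/XY | j ji y /(Y'j _ ji)].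
Qed.

(* Bounds the number of vertices, divided by [n], that allows [k] steps of
   [sparse_chain]. *)
Fixpoint chain_coef (r q0 k : nat) : nat :=
  if k is k'.+1
  then (2 * q0 * (2 * q0) ^ r) ^ r * (1 + r.+1 * chain_coef r q0 k')
  else (2 * q0) ^ r * r.+2.

Lemma chain_coef_gt0 r q0 k : 0 < q0 -> 0 < chain_coef r q0 k.
Proof. by case: k => [|k] h /=; rewrite !(muln_gt0, expn_gt0, h). Qed.

Lemma quasirandom_arrows {T : finType} (Delta m n q0 : nat) (F : sgraph T) :
  0 < q0 -> 0 < n -> quasirandom n q0 F ->
  chain_coef (Delta + m) q0 (Delta + m).+1 * n <= #|T| ->
  universal_arrows Delta m n F.
Proof.
move=> q0_gt0 n0 Fq large V G Vn degG col.
have V0 : 0 < #|V| by rewrite Vn.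
set r := Delta + m in large.
(* Blue keeps half of the density 1/q0, hence [q2]. Fewer than |Y j| / q1 red neighbours in [Y j]
   are fewer than |Z| / q2 for every [Z] with |Y j| <= q2 ^ r * |Z|. *)
set q2 := 2 * q0; set q1 := q2 * q2 ^ r.
have q2_gt0 : 0 < q2 by rewrite muln_gt0.
have q2r : 0 < q2 ^ r by rewrite expn_gt0 q2_gt0.
have q1_gt0 : 0 < q1 by rewrite muln_gt0 q2_gt0.
have [||//|[Y YP]] := sparse_chain F col true G q1 Delta m
  (fun k => chain_coef r q0 k * n) r.+1 [set: T]%SET q1_gt0 V0 degG.
- by move=> i; rewrite /= Vn -/r -/q2 -/q1; ring.
- by rewrite cardsT.
(* For a = n the parts must have q2 ^ r * (r + 2) * n vertices, which is [chain_coef r q0 0 * n]. *)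
apply: (dense_monochromatic_copy F col false G q2 Delta m n Y) => //; last first.
  move=> i ir; have [_ + _] := YP i ir; rewrite /= Vn -/r -/q2.
  by rewrite -mulnA mulSn.
move=> i j X Z /andP[ji ir] XY ZY nX Zlarge.
have [_ _ YiP] := YP i ir.
have [_ Yj _] := YP j (ltn_trans ji ir).
have nZ : n <= #|Z|.
  have := leq_trans Yj Zlarge; rewrite /= -/q2 -mulnA leq_pmul2l // mulSn; lia.
have [x xX xZ] := Fq X Z nX nZ; exists x => //.
have := YiP j ji x (fintype.subsetP XY x xX).
set NF := Z :&: _ in xZ; set NB := Z :&: _; set NR := Y j :&: _ => sparse.
have NFle : #|NF| <= #|NB| + #|NR|.
  apply: leq_trans (leq_card_setU _ _); apply: subset_leq_card.
  apply/fintype.subsetP => y; rewrite !inE /colour_class => /andP[yZ xy].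
  by rewrite xy yZ (fintype.subsetP ZY y yZ); case: (col _).
have NRlt : q2 * #|NR| < #|Z|.
  rewrite -(ltn_pmul2l q2r) mulnA (mulnC _ q2); exact: leq_trans sparse Zlarge.
have : q2 * #|NF| <= q2 * #|NB| + q2 * #|NR| by rewrite -mulnDr leq_mul2l NFle orbT.
rewrite {1}/q2 -mulnA; lia.
Qed.

(** * Counting edges between two vertex sets *)

(** [X] and [Y] may overlap: [pairs T] discards the singletons that come from equal entries, and an
    edge inside both sets counts once. *)
Definition edges_between {T : finType} (X Y : {set T}) : {set {set T}} :=
  pairs T :&: [set [set u.1; u.2] | u in finset.setX X Y].

Lemma leq_card_fibres {T U : finType} (A : {set T}) (B : {set U}) (h : T -> U)
    (k : U -> nat) :
  {in A, forall x, h x \in B} ->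
  {in B, forall y, #|[set x in A | h x == y]| <= k y} ->
  #|A| <= \sum_(y in B) k y.
Proof.
move=> AB kB; rewrite -sum1_card (partition_big h (mem B)) //=.
apply: leq_sum => y /kB; apply: leq_trans.
by rewrite -sum1_card; apply: eq_leq; apply: eq_bigl => x; rewrite inE.
Qed.

(** An edge comes from at most two ordered pairs, and the diagonal has at most |X| elements. *)
Lemma card_edges_between {T : finType} (X Y : {set T}) :
  #|X| * #|Y| <= 2 * #|edges_between X Y| + #|X|.
Proof.
rewrite -cardsX -(cardsID [set u | u.1 != u.2] (finset.setX X Y)) leq_add //.
  rewrite mulnC -sum_nat_const.
  apply: (leq_card_fibres _ _ (fun u => [set u.1; u.2])).
    move=> u; rewrite inE => /andP[uXY]; rewrite inE => u12.
    rewrite inE inE cards2 u12 /=.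
    by apply/imsetP; exists u.
  move=> e; rewrite inE inE => /andP[/eqP e2 _]; rewrite -e2.
  rewrite -(card_in_imset (f := fst)).
    apply: subset_leq_card; apply/fintype.subsetP => _ /imsetP[u uP ->].
    by move: uP; rewrite inE => /andP[_ /eqP <-]; rewrite set21.
  move=> [x y] [x' y'] /=; rewrite !inE /= => /andP[/andP[_ xy] /eqP xye].
  move=> /andP[/andP[_ xy'] /eqP xye'] xx'; rewrite -{x'}xx' in xy' xye' *.
  have : y \in [set x; y'] by rewrite xye' -xye set22.
  by rewrite !inE eq_sym (negPf xy) => /eqP ->.
rewrite -(card_in_imset (f := fst)).
  apply: subset_leq_card; apply/fintype.subsetP => _ /imsetP[u uP ->].
  by move: uP; rewrite !inE => /and3P[].
move=> [x y] [x' y'] /=; rewrite !inE /= !negbK.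
by move=> /andP[/eqP <- _] /andP[/eqP <- _] ->.
Qed.

Lemma card_sparse_edges_between {T : finType} (F : sgraph T) (X Y : {set T})
    (q0 : nat) :
  {in X, forall x, q0 * #|Y :&: [set y | [set x; y] \in edges F]| <= #|Y|} ->
  q0 * #|edges F :&: edges_between X Y| <= #|X| * #|Y|.
Proof.
move=> sparse; rewrite -sum_nat_const.
apply: (@leq_trans (\sum_(x in X) q0 * #|Y :&: [set y | [set x; y] \in edges F]|));
  last exact: leq_sum.
rewrite -big_distrr leq_mul2l; apply/orP; right.
pose A := [set u in finset.setX X Y | [set u.1; u.2] \in edges F].
apply: (@leq_trans #|A|).
  apply: leq_trans (leq_imset_card (fun u => [set u.1; u.2]) _).
  apply: subset_leq_card; apply/fintype.subsetP => e; rewrite inE => /andP[eF].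
  rewrite inE => /andP[_ /imsetP[u uXY eu]]; apply/imsetP; exists u => //.
  by rewrite inE uXY -eu.
apply: (leq_card_fibres _ _ fst) => [u|x xX].
  by rewrite !inE => /andP[/andP[]].
rewrite -(card_in_imset (f := snd)).
  apply: subset_leq_card; apply/fintype.subsetP => _ /imsetP[u uP ->].
  by move: uP; rewrite !inE => /andP[/andP[/andP[_ ->] uF] /eqP <-].
move=> [x1 y1] [x2 y2] /=; rewrite !inE /=.
by move=> /andP[_ /eqP ->] /andP[_ /eqP ->] ->.
Qed.

(** * Probability estimates in G(N, p) *)

Local Open Scope classical_set_scope.
Local Open Scope ring_scope.
Import Order.TTheory GRing.Theory Num.Theory.

Lemma sum_sgraph_prod (R : comNzRingType) (T : finType) (f g : {set T} -> R) :
  \sum_(F : sgraph T) \prod_(e in pairs T) (if e \in edges F then f e else g e)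
  = \prod_(e in pairs T) (f e + g e).
Proof.
(* Outside [pairs T] the factors are 0 + 1, so the expansion over all sets [J] keeps only edge sets
   of graphs. *)
pose f' e := if e \in pairs T then f e else 0.
pose g' e := if e \in pairs T then g e else 1.
have -> : \prod_(e in pairs T) (f e + g e) = \prod_e (f' e + g' e).
  rewrite big_mkcond; apply: eq_bigr => e _; rewrite /f' /g'.
  by case: ifP; rewrite ?add0r.
rewrite bigA_distr (bigID (fun J : {set {set T}} => J \subset pairs T)) /=.
rewrite [X in _ + X]big1 ?addr0.
  rewrite (reindex_omap (@edges T) insub) /=; last first.
    by move=> J JT; rewrite insubT.
  apply: eq_big => [F|F _]; first by rewrite valK eqxx edges_sub.
  rewrite big_mkcond; apply: eq_bigr => e _; rewrite /f' /g'.
  case: ifP => // eT; case: ifP => // eF.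
  by rewrite (fintype.subsetP (edges_sub F) _ eF) in eT.
move=> J /subsetPn[e eJ eT].
by rewrite (bigD1 e) //= eJ /f' (negPf eT) mul0r.
Qed.

Lemma gnp_weight_ge0 (R : realType) (N : nat) (p : R) (F : sgraph 'I_N) :
  0 <= p <= 1 -> 0 <= gnp_weight p F.
Proof.
move=> /andP[p0 p1]; apply: prodr_ge0 => e _; case: ifP => // _.
by rewrite subr_ge0.
Qed.

Lemma sum_gnp_weight (R : realType) (N : nat) (p : R) :
  \sum_(F : sgraph 'I_N) gnp_weight p F = 1.
Proof. by rewrite sum_sgraph_prod big1 // => e _; rewrite subrKC. Qed.

(** By independence each pair in [P] contributes the factor p/2 + (1 - p), and every other pair the
    factor 1. *)
Lemma gnp_moment (R : realType) (N : nat) (p : R) (P : {set {set 'I_N}}) :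
  P \subset pairs 'I_N ->
  \sum_(F : sgraph 'I_N) gnp_weight p F * 2^-1 ^+ #|edges F :&: P|
  = (1 - p / 2) ^+ #|P|.
Proof.
move=> PT.
have powE (A : {set {set 'I_N}}) (x : R) : A \subset pairs 'I_N ->
    x ^+ #|A| = \prod_(e in pairs 'I_N) (if e \in A then x else 1).
  move=> AT; rewrite -big_mkcondr /= -prodr_const; apply: eq_bigl => e.
  by rewrite andbC; case: (boolP (e \in A)) => //= /(fintype.subsetP AT) ->.
rewrite powE //.
transitivity (\prod_(e in pairs 'I_N) (p * (if e \in P then 2^-1 else 1) + (1 - p))).
  rewrite -sum_sgraph_prod; apply: eq_bigr => F _.
  rewrite powE ?(fintype.subset_trans (finset.subsetIr _ _)) // -big_split /=.
  apply: eq_bigr => e _; rewrite inE.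
  by case: (e \in edges F); rewrite ?mulr1.
by apply: eq_bigr => e _; case: ifP => _; field.
Qed.

(** For one pair (X, Y) with M = |E| / k rounded down, Markov's inequality bounds the failure
    probability by 2 ^ M * (1 - p/2) ^ |E| <= 2 ^ M * 4 ^ - M <= 2 ^ - t. *)
Lemma gnp_quasirandom (R : realType) (N n k t : nat) (p : R) :
  0 <= p <= 1 -> (1 < n)%N -> (0 < k)%N -> (4 * (k * t.+1) <= n * n)%N ->
  (1 - p / 2) ^+ k <= 4^-1 ->
  1 - 4 ^+ N / 2 ^+ t <= gnp_prob p [set F : sgraph 'I_N | quasirandom n (4 * k) F].
Proof.
move=> p01 n1 k0 tn pk.
rewrite lerBlDr -[leLHS](@sum_gnp_weight R N p) /gnp_prob.
pose E (u : {set 'I_N} * {set 'I_N}) := edges_between u.1 u.2.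
pose large (u : {set 'I_N} * {set 'I_N}) := (n <= #|u.1|)%N && (n <= #|u.2|)%N.
pose M (u : {set 'I_N} * {set 'I_N}) := (#|E u| %/ k)%N.
(* Since |Y| >= 2, the diagonal term |X| is at most half of |X| * |Y|. The resulting 4 cancels
   against the one in [4 * k] in the next claim. *)
have card_E u : large u -> (#|u.1| * #|u.2| <= 4 * #|E u|)%N.
  by move=> /andP[X Y]; have := card_edges_between u.1 u.2; rewrite -/(E u); nia.
have bad F : ~ quasirandom n (4 * k) F ->
    exists2 u, large u & (#|edges F :&: E u| <= M u)%N.
  move=> Fq; apply: contrapT => nu; apply: Fq => X Y nX nY.
  have [x /andP[xX xY]|none] := pickP [pred x in X |
     (#|Y| <= 4 * k * #|Y :&: [set y | [set x; y] \in edges F]%SET|)%N].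
    by exists x.
  case: nu; exists (X, Y); first by rewrite /large nX nY.
  rewrite leq_divRL //.
  have XY : large (X, Y) by rewrite /large nX nY.
  have := @card_sparse_edges_between _ F X Y (4 * k) _.
  have := card_E _ XY; rewrite /E /= => h1 h2.
  have : (4 * k * #|edges F :&: edges_between X Y| <= #|X| * #|Y|)%N.
    apply: h2 => x xX; have /= := none x; rewrite xX /= => /negbT.
    by rewrite -ltnNge => /ltnW.
  rewrite /E /=; nia.
(* Markov and the union bound hold pointwise: if [F] fails at [u], the summand of [u] is at least
   [gnp_weight p F]. *)
have step F : gnp_weight p F <=
    (if F \in [set F : sgraph 'I_N | quasirandom n (4 * k) F]
     then gnp_weight p F else 0) +
    \sum_(u | large u) 2 ^+ M u * (gnp_weight p F * 2^-1 ^+ #|edges F :&: E u|).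
  have w0 := gnp_weight_ge0 R N p F p01.
  have s0 u : 0 <= 2 ^+ M u * (gnp_weight p F * 2^-1 ^+ #|edges F :&: E u|).
    by rewrite !mulr_ge0 // exprn_ge0.
  case: ifPn => [_|]; first by rewrite lerDl sumr_ge0.
  rewrite notin_setE => /= /bad[u lu uM]; rewrite add0r (bigD1 u) //=.
  rewrite -[leLHS]addr0 lerD ?sumr_ge0 // mulrCA ler_peMr //.
  rewrite exprVn ler_pdivlMr ?exprn_gt0 // mul1r.
  by rewrite ler_weXn2l // ler1n.
apply: le_trans (ler_sum _ (fun F _ => step F)) _.
rewrite big_split /= -big_mkcond lerD2l exchange_big /=.
have -> : 4 ^+ N / 2 ^+ t = \sum_(u : {set 'I_N} * {set 'I_N}) (2 ^+ t)^-1 :> R.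
  rewrite sumr_const card_prod -cardsT -powersetT card_powerset cardsT card_ord.
  by rewrite -expnMn -[RHS]mulr_natl natrX.
rewrite [leRHS](bigID large) /= -[leLHS]addr0.
apply: lerD; last by apply: sumr_ge0 => u _; rewrite invr_ge0 exprn_ge0.
apply: ler_sum => u lu; rewrite -mulr_sumr gnp_moment ?finset.subsetIl //.
have tM : (t <= M u)%N.
  rewrite leq_divRL //; have := card_E u lu; case/andP: lu => X Y.
  by nia.
have rho01 : 0 <= 1 - p / 2 <= 1 by case/andP: p01 => p0 p1; apply/andP; split; lra.
have : (1 - p / 2) ^+ #|E u| <= (4^-1) ^+ M u.
  apply: (@le_trans _ _ ((1 - p / 2) ^+ (k * M u))).
    by case/andP: rho01 => r0 r1; apply: ler_wiXn2l; rewrite // mulnC leq_divM.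
  by rewrite exprM lerXn2r // ?nnegrE ?exprn_ge0 ?invr_ge0 //; case/andP: rho01.
move=> /(ler_wpM2l (exprn_ge0 (M u) (ler0n R 2))) /le_trans; apply.
rewrite -exprMn (_ : 2 * 4^-1 = 2^-1); last by field.
by rewrite -exprVn ler_wiXn2l // ?invr_ge0 // invf_le1 // ler1n.
Qed.

Lemma gnp_prob_le1 (R : realType) (N : nat) (p : R) (P : set (sgraph 'I_N)) :
  0 <= p <= 1 -> gnp_prob p P <= 1.
Proof.
move=> p01; rewrite -(@sum_gnp_weight R N p) [leRHS](bigID (fun F => F \in P)) /=.
by rewrite lerDl sumr_ge0 // => F _; apply: gnp_weight_ge0.
Qed.

Lemma gnp_prob_subset (R : realType) (N : nat) (p : R)
    (P Q : set (sgraph 'I_N)) :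
  0 <= p <= 1 -> P `<=` Q -> gnp_prob p P <= gnp_prob p Q.
Proof.
move=> p01 PQ; rewrite /gnp_prob big_mkcond [leRHS]big_mkcond; apply: ler_sum.
move=> F _; have w0 := gnp_weight_ge0 R N p F p01.
case: ifPn => [|_]; last by case: ifP.
by rewrite inE => /PQ PF; rewrite ifT // inE.
Qed.

(** * Choice of the constants and the limit *)

Theorem theorem2 (R : realType) (Delta m : nat) (p : R)
    (Delta_gt0 : (0 < Delta)%N) (m_gt0 : (0 < m)%N)
    (p_gt0 : 0 < p) (p_le1 : p <= 1) :
  exists c : nat, (0 < c)%N /\
    (fun n : nat =>
       gnp_prob p [set F : sgraph 'I_(c * n) | universal_arrows Delta m n F])
      @ \oo --> (1 : R).
Proof.
have p01 : 0 <= p <= 1 by rewrite ltW.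
have [k k0 pk] : exists2 k, (0 < k)%N & (1 - p / 2) ^+ k <= 4^-1.
  have rho1 : `|1 - p / 2| < 1 by rewrite ger0_norm; lra.
  have /cvgrPdist_le/(_ 4^-1) := cvg_expr rho1.
  rewrite invr_gt0 ltr0n => /(_ isT)[k _ kP]; exists k.+1 => //.
  by have := kP k.+1 (leqnSn k); rewrite /= sub0r normrN => /(le_trans (ler_norm _)).
pose c := chain_coef (Delta + m) (4 * k) (Delta + m).+1.
have q0 : (0 < 4 * k)%N by rewrite muln_gt0.
exists c; split; first exact: chain_coef_gt0.
apply: (@squeeze_cvgr _ _ _ _ (fun n => 1 - 2^-1 ^+ n) (fun=> 1)); last 2 first.
- rewrite -[X in _ --> X]subr0; apply: cvgB; first exact: cvg_cst.
  by apply: cvg_expr; rewrite ger0_norm ?invr_ge0 // invf_lt1 // ltr1n.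
- exact: cvg_cst.
(* For t = 2cn + n this threshold gives 4k(t + 1) <= 4k(2c + 2)n <= n * n. *)
exists (4 * k * (2 * c + 2))%N => // n /= nlarge; rewrite gnp_prob_le1 // andbT.
have n1 : (1 < n)%N by nia.
apply: le_trans
  (_ : gnp_prob p [set F : sgraph 'I_(c * n) | quasirandom n (4 * k) F] <= _).
  (* In t, the summand 2cn cancels the 4 ^ (cn) of the union bound and the summand n leaves the
     error 2 ^ - n. *)
  apply: le_trans (gnp_quasirandom R (c * n) n k (2 * (c * n) + n) p p01 n1 k0 _ pk).
    rewrite lerD2l lerN2 exprD [_ ^+ (2 * _)]exprM invfM mulrA (_ : 2 ^+ 2 = 4 :> R).
      by rewrite divff ?mul1r ?exprVn // expf_neq0.
    by rewrite -natrX.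
  nia.
apply: gnp_prob_subset => // F /= Fq.
by apply: quasirandom_arrows Fq _ => //; [lia | rewrite card_ord].
Qed.
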